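(* For any graph $G$, $\mathbb{c}_2(G)>\mathbb{E}_r(G)$, where $\mathbb{c}_2(G)$ is the subgraph complementation number of $G$ and $\mathbb{E}_r(G)$ is the average Schmidt-rank of the graph state $|G\rangle$.
   Context: All graphs are finite, simple and undirected. For a graph $G=(V,E)$ and $V'\subseteq V$, the subgraph complementation (SC) operation on $V'$ complements the subgraph induced on $V'$: every pair of distinct vertices of $V'$ that is an edge becomes a non-edge and vice versa; all other pairs are unchanged. A subgraph complementation system for $G$ is a finite collection $\{V_1,\dots,V_d\}$ of subsets of $V$ such that successively applying the SC operations on $V_1,\dots,V_d$ to the edgeless graph on $V$ produces $G$; equivalently, for all distinct $u,v\in V$, $uv\in E$ if and only if the number of indices $i$ with $\{u,v\}\subseteq V_i$ is odd. The subgraph complementation number $\mathbb{c}_2(G)$ is the minimum size $d$ of such a system. The graph state of $G=(V,E)$ is $|G\rangle=\prod_{\{a,b\}\in E}CZ_{ab}\,|+\rangle^{\otimes V}\in(\mathbb{C}^2)^{\otimes V}$, where $|+\rangle=(|0\rangle+|1\rangle)/\sqrt2$ and $CZ_{ab}$ is the controlled-$Z$ gate on qubits $a,b$. For $X\subseteq V$, the Schmidt-rank $r_G(X)$ of $|G\rangle$ with respect to the bipartition $(X,V\setminus X)$ is $\log_2$ of the minimal number of terms $|\phi_j\rangle\otimes|\psi_j\rangle$, with $|\phi_j\rangle\in(\mathbb{C}^2)^{\otimes X}$ and $|\psi_j\rangle\in(\mathbb{C}^2)^{\otimes (V\setminus X)}$, in a decomposition $|G\rangle=\sum_j|\phi_j\rangle\otimes|\psi_j\rangle$.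 (In the cases $X=\emptyset$ and $X=V$ one has $r_G(X)=0$.) The average Schmidt-rank is $\mathbb{E}_r(G)=2^{-|V|}\sum_{X\subseteq V}r_G(X)$, the expectation of $r_G(X)$ for a uniformly random subset $X$ of $V$.
   Formalization: The formal statement assumes that G has at least one edge; for edgeless graphs both the subgraph complementation number and the average Schmidt-rank are 0, so the strict inequality fails there. *)

(* Defs.v *)
From HB Require Import structures.
From mathcomp Require Import all_boot all_order all_algebra complex.
From mathcomp Require Import boolp reals exp.
Set Implicit Arguments.
Unset Strict Implicit.
Unset Printing Implicit Defensive.
Import Order.TTheory GRing.Theory Num.Theory.
Local Open Scope ring_scope.
Local Open Scope complex_scope.

Record sgraph (V : finType) := SGraph {
  adj : rel V;
  adj_sym : symmetric adj;
  adj_irr : irreflexive adj }.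

(* Every undirected edge occurs exactly once in [edges G]: it is listed with
   its endpoints in the order of the enumeration of [V]. *)
Definition edges (V : finType) (G : sgraph V) : {set V * V} :=
  [set p | adj G p.1 p.2 & (enum_rank p.1 < enum_rank p.2)%N].

Section SubgraphComplementation.
Variable V : finType.
Implicit Types (G H : sgraph V) (A : {set V}) (s : seq {set V}).

Definition edgeless : sgraph V :=
  @SGraph V (fun _ _ => false) (fun _ _ => erefl) (fun _ => erefl).

Definition sc_rel A (e : rel V) : rel V := fun u v =>
  if [&& u \in A, v \in A & u != v] then ~~ e u v else e u v.

Lemma sc_rel_sym A G : symmetric (sc_rel A (adj G)).
Proof.
by move=> u v; rewrite /sc_rel adj_sym (eq_sym u) andbCA.
Qed.

Lemma sc_rel_irr A G : irreflexive (sc_rel A (adj G)).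
Proof. by move=> u; rewrite /sc_rel eqxx !andbF adj_irr. Qed.

Definition sc G A : sgraph V := SGraph (sc_rel_sym A G) (sc_rel_irr A G).

Definition is_sc_system G s : bool :=
  [forall u, forall v, adj (foldl sc edgeless s) u v == adj G u v].

Lemma adj_foldl_sc G s u v :
  adj (foldl sc G s) u v =
  adj G u v (+) ((u != v) && odd (count (fun A => (u \in A) && (v \in A)) s)).
Proof.
elim: s G => [|A s IHs] G /=; first by rewrite andbF addbF.
rewrite IHs /= /sc_rel oddD.
by case: (u \in A); case: (v \in A); case: (u != v); case: (adj G u v);
   case: (odd _).
Qed.

Lemma is_sc_systemP G s :
  reflect (forall u v, u != v ->
             adj G u v = odd (count (fun A => (u \in A) && (v \in A)) s))
          (is_sc_system G s).
Proof.
apply: (iffP forallP) => [sG u v uv|sG u].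
  by have /forallP/(_ v)/eqP <- := sG u; rewrite adj_foldl_sc uv.
apply/forallP => v; rewrite adj_foldl_sc /=.
by case: (eqVneq u v) => [->|uv] /=; [rewrite adj_irr | rewrite (sG _ _ uv)].
Qed.

Lemma sc_system_exists G :
  exists d, [exists s : d.-tuple {set V}, is_sc_system G s].
Proof.
pose s := [seq [set p.1; p.2] | p <- enum (edges G)].
exists (size s); apply/existsP; exists (in_tuple s); apply/is_sc_systemP.
suff H u v : (enum_rank u < enum_rank v)%N ->
    adj G u v = odd (count (fun A => (u \in A) && (v \in A)) s).
  move=> u v uv; case: (ltngtP (enum_rank u) (enum_rank v)) => [||/val_inj].
  - exact: H.
  - move=> vu; rewrite adj_sym (H _ _ vu); congr odd.
    by apply: eq_count => A; rewrite andbC.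
  - by move/enum_rank_inj => eq_uv; rewrite eq_uv eqxx in uv.
move=> uv; rewrite /s count_map.
have -> : count (preim (fun p : V * V => [set p.1; p.2])
    (fun A : {set V} => (u \in A) && (v \in A))) (enum (edges G))
    = count_mem (u, v) (enum (edges G)).
  apply: eq_in_count => -[a b]; rewrite mem_enum !inE /= => /andP[_ ab].
  rewrite xpair_eqE ![_ == a]eq_sym ![_ == b]eq_sym.
  apply/idP/idP => [|/andP[/eqP-> /eqP->]]; last by rewrite !eqxx orbT.
  move=> /andP[/orP[]/eqP eu /orP[]/eqP ev]; subst.
  - by rewrite ltnn in uv.
  - by rewrite !eqxx.
  - by have := ltn_trans uv ab; rewrite ltnn.
  - by rewrite ltnn in uv.
by rewrite count_uniq_mem ?enum_uniq // mem_enum inE /= uv andbT oddb.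
Qed.

Definition c2 G : nat := ex_minn (sc_system_exists G).

End SubgraphComplementation.

Section GraphState.
Variable R : realType.
Implicit Types V : finType.

(* (C^2)^{\otimes V}, by coordinates in the computational basis: the basis
   vectors are indexed by the bit assignments [x : {ffun V -> bool}]. *)
Definition qstate V := {ffun {ffun V -> bool} -> R[i]}.

(* |+> = (|0> + |1>) / sqrt 2 *)
Definition ket_plus : {ffun bool -> R[i]} := [ffun => (Num.sqrt (2 : R))^-1%:C].

Definition plus_state V : qstate V := [ffun x : {ffun V -> bool} =>
  \prod_(v : V) ket_plus (x v)].

Definition CZ V (a b : V) (psi : qstate V) : qstate V :=
  [ffun x : {ffun V -> bool} => (if x a && x b then -1 else 1) * psi x].

(* The order of the edges is irrelevant since the CZ gates commute. *)
Definition graph_state V (G : sgraph V) : qstate V :=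
  foldr (fun p => CZ p.1 p.2) (plus_state V) (enum (edges G)).

Definition restrict V (X : {set V}) (x : {ffun V -> bool}) :
  {ffun {v | v \in X} -> bool} := [ffun v => x (val v)].

Definition tensor V (X : {set V})
    (phi : qstate {v | v \in X}) (psi : qstate {v | v \in ~: X}) : qstate V :=
  [ffun x => phi (restrict X x) * psi (restrict (~: X) x)].

Definition schmidt_decomposable V (X : {set V}) (Psi : qstate V) (k : nat) :=
  exists (phi : 'I_k -> qstate {v | v \in X})
         (psi : 'I_k -> qstate {v | v \in ~: X}),
    Psi = \sum_(j < k) tensor (phi j) (psi j).

Lemma schmidt_decomposable_exists V (X : {set V}) (Psi : qstate V) :
  exists k, `[< schmidt_decomposable X Psi k >].
Proof.
pose T := {ffun {v | v \in X} -> bool}.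
pose glue (y : T) (z : {ffun {v | v \in ~: X} -> bool}) : {ffun V -> bool} :=
  [ffun v => if insub v is Some w then y w
             else if insub v is Some w then z w else false].
have glueE x : glue (restrict X x) (restrict (~: X) x) = x.
  apply/ffunP => v; rewrite ffunE; case: insubP => [w _ <-|vX].
    by rewrite ffunE.
  case: insubP => [w _ <-|]; first by rewrite ffunE.
  by rewrite inE vX.
exists #|T|; apply/asboolP.
exists (fun j => [ffun y => (y == enum_val j)%:R]).
exists (fun j => [ffun z => Psi (glue (enum_val j) z)]).
apply/ffunP => x; rewrite sum_ffunE.
rewrite (bigD1 (enum_rank (restrict X x))) //= !ffunE enum_rankK eqxx mul1r.
rewrite glueE big1 ?addr0 // => j jx; rewrite !ffunE.
case: eqP => [xj|_]; last by rewrite mul0r.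
by rewrite xj enum_valK eqxx in jx.
Qed.

Definition min_schmidt_terms V (X : {set V}) (Psi : qstate V) : nat :=
  ex_minn (schmidt_decomposable_exists X Psi).

Definition schmidt_rank V (G : sgraph V) (X : {set V}) : R :=
  ln (min_schmidt_terms X (graph_state G))%:R / ln 2.

Definition avg_schmidt_rank V (G : sgraph V) : R :=
  (2 ^+ #|V|)^-1 * \sum_(X : {set V}) schmidt_rank G X.

End GraphState.

(* Main.v *)
(* If V_1, ..., V_d is a subgraph complementation system for G, then the
   amplitude of |G> at x is, up to a constant, the sign (-1)^q with
   q = \sum_i C(|x \cap V_i|, 2).  As C(a + b, 2) = C(a, 2) + C(b, 2) + a b,
   across a cut (X, V \ X) the two halves of x interact only through the d
   parities of |x \cap V_i \cap X|.  Summing over the 2^d values of these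
   parities decomposes |G> into 2^d product terms, so r_G(X) <= d for all X.
   The inequality is strict on average since r_G(set0) = 0 < d. *)
Require Import Defs.
From mathcomp Require Import all_boot all_order all_algebra reals.
From mathcomp Require Import complex boolp exp zify.
Local Open Scope ring_scope.
Set Implicit Arguments.
Unset Strict Implicit.
Unset Printing Implicit Defensive.
Import Order.TTheory GRing.Theory Num.Theory.

(* [restrict] would otherwise denote the restriction of matrices. *)
Local Notation restrict := Defs.restrict.

Section PairCount.
Variable V : finType.
Implicit Types S A B : {set V}.

(** The binomial coefficient C(#|S|, 2): comparing ranks counts each unordered pair once, matching
    the orientation in [edges]. *)
Definition npairs S : nat :=
  (\sum_(u in S) \sum_(v in S) (enum_rank u < enum_rank v))%N.

Lemma npairs_double S : (npairs S + npairs S + #|S| = #|S| * #|S|)%N.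
Proof.
have diag u : u \in S -> (\sum_(v in S) (u == v) = 1)%N.
  move=> uS; rewrite (bigD1 u) //= eqxx big1 // => v /andP[_ vu].
  by rewrite eq_sym (negPf vu).
have cardS : (\sum_(u in S) \sum_(v in S) (u == v) = #|S|)%N.
  by rewrite (eq_bigr _ diag) sum1_card.
(* The three summands count the increasing, decreasing and diagonal pairs of S x S. *)
rewrite {2}/npairs exchange_big /= -[in LHS]cardS.
rewrite -!big_split /= -[RHS]sum_nat_const; apply: eq_bigr => u _.
rewrite -!big_split /= -[RHS]sum1_card; apply: eq_bigr => v _.
by rewrite -(inj_eq enum_rank_inj) -val_eqE /=; case: ltngtP.
Qed.

Lemma npairsU A B : [disjoint A & B] ->
  npairs (A :|: B) = (npairs A + npairs B + #|A| * #|B|)%N.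
Proof.
move=> dAB; have := npairs_double (A :|: B).
rewrite cardsU (disjoint_setI0 dAB) cards0 subn0.
have := npairs_double A; have := npairs_double B.
by nia.
Qed.

End PairCount.

Definition ones (V : finType) (x : {ffun V -> bool}) : {set V} :=
  [set v | x v].

(** Padding with zeros turns each half of an assignment into one on all of [V], so that both halves
    can be intersected with the same sets of the system. *)
Definition extend0 (V : finType) (X : {set V})
    (y : {ffun {v | v \in X} -> bool}) : {ffun V -> bool} :=
  [ffun v => if insub v is Some w then y w else false].

Lemma ones_extend0_restrict (V : finType) (X : {set V}) (x : {ffun V -> bool}) :
  ones (extend0 (restrict X x)) = ones x :&: X.
Proof.
apply/setP => v; rewrite !inE ffunE.
by case: insubP => [w vX <-|/negPf ->]; rewrite ?andbF // ffunE (valP w) andbT.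
Qed.

Section Amplitude.
Variables (R : realType) (V : finType).
Implicit Types (G : sgraph V) (X : {set V}) (x : {ffun V -> bool}).

Lemma graph_stateE G x :
  graph_state R G x = plus_state R V x * (-1) ^+
    (\sum_(p in edges G) (x p.1 && x p.2))%N.
Proof.
rewrite -big_enum /graph_state; elim: (enum _) => [|p e IHe] /=.
  by rewrite big_nil mulr1.
rewrite ffunE IHe big_cons exprD mulrCA; congr (_ * (_ * _)).
by case: (_ && _).
Qed.

(** Double counting of pairs inside [ones x]: the right-hand sum counts a pair once for each set
    containing it, which is an odd number of times exactly for edges. *)
Lemma sum_edges_npairs G (s : seq {set V}) x : is_sc_system G s ->
  odd (\sum_(p in edges G) (x p.1 && x p.2)) =
  odd (\sum_(A <- s) npairs (A :&: ones x)).
Proof.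
move=> /is_sc_systemP sG.
have -> : (\sum_(A <- s) npairs (A :&: ones x) =
    \sum_u \sum_v count (fun A : {set V} => (u \in A) && (v \in A)) s *
      [&& x u, x v & enum_rank u < enum_rank v])%N.
  transitivity (\sum_(A <- s) \sum_u \sum_v ((u \in A) && (v \in A)) *
      [&& x u, x v & enum_rank u < enum_rank v])%N.
    apply: eq_bigr => A _; rewrite /npairs big_mkcond; apply: eq_bigr => u _.
    rewrite inE inE; case: (u \in A) => /=; last by rewrite big1.
    case: (x u) => /=; last by rewrite big1 // => v _; rewrite muln0.
    rewrite big_mkcond; apply: eq_bigr => v _; rewrite inE inE.
    by case: (v \in A); case: (x v) => //=; rewrite ?mul1n.
  rewrite exchange_big; apply: eq_bigr => u _.
  rewrite exchange_big; apply: eq_bigr => v _.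
  by rewrite -big_distrl /= -sum1_count [in RHS]big_mkcond.
rewrite pair_big /= big_mkcond /= !(big_morph odd oddD (erefl _)).
apply: eq_bigr => -[u v] _; rewrite inE /= oddM oddb.
case: (ltnP (enum_rank u) (enum_rank v)) => [uv|_]; last by rewrite !andbF.
rewrite andbT -sG; last by apply: contraTneq uv => ->; rewrite ltnn.
by case: (adj G u v); rewrite // andbT oddb.
Qed.

Lemma graph_state_sc G (s : seq {set V}) x : is_sc_system G s ->
  graph_state R G x =
  plus_state R V x * \prod_(A <- s) (-1) ^+ npairs (A :&: ones x).
Proof.
move=> /(sum_edges_npairs x) odd_s; rewrite graph_stateE -signr_odd odd_s.
by rewrite signr_odd (big_morph _ (exprD (-1)) (expr0 _)).
Qed.

Lemma plus_stateE x y : plus_state R V x = plus_state R V y.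
Proof. by rewrite !ffunE; apply: eq_bigr => v _; rewrite !ffunE. Qed.

Lemma graph_state_factor G X d (s : d.-tuple {set V}) : is_sc_system G s ->
  exists f (a : _ -> {ffun 'I_d -> bool}) g, forall x,
    graph_state R G x =
    f (restrict X x) * g (a (restrict X x)) (restrict (~: X) x).
Proof.
move=> sG; pose S (Y : {set V}) (y : {ffun {v | v \in Y} -> bool}) i :=
  tnth s i :&: ones (extend0 y).
(* The uniform amplitude goes into the X-factor; [a] records the parities, and [g] carries the cross
   terms. *)
exists (fun y => plus_state R V (extend0 y) * \prod_i (-1) ^+ npairs (S X y i)).
exists (fun y => [ffun i => odd #|S X y i|]).
exists (fun (t : {ffun _ -> bool}) z => \prod_i (-1) ^+ (npairs (S _ z i) + t i * #|S _ z i|)%N).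
move=> x; rewrite (graph_state_sc x sG) big_tuple -mulrA -big_split /=.
rewrite (plus_stateE x (extend0 (restrict X x))); congr (_ * _).
apply: eq_bigr => i _; rewrite -exprD ffunE /S !ones_extend0_restrict.
set B := tnth s i; have -> : B :&: ones x =
    (B :&: (ones x :&: X)) :|: (B :&: (ones x :&: ~: X)).
  by rewrite -setIUr -setIUr setUCr setIT.
rewrite npairsU; last first.
  rewrite -setI_eq0; apply/eqP/setP => v; rewrite !inE.
  by case: (v \in X); rewrite !andbF.
(* A sign sees only the parity of its exponent, so a recorded parity can replace the cardinality in
   the cross term. *)
rewrite -[LHS]signr_odd -[RHS]signr_odd !oddD !oddM oddb.
by rewrite addbA.
Qed.

End Amplitude.

Section Decomposition.
Variables (R : realType) (V : finType).
Implicit Types (G : sgraph V) (X : {set V}).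

(** One product term per value t of [a]: [f] cut down to the fibre of t, times [g t]. At a given [x]
    only the term of its own fibre survives. *)
Lemma schmidt_decomposable_factor X (Psi : qstate R V) (T : finType) f
    (a : _ -> T) g :
  (forall x : {ffun V -> bool},
    Psi x = f (restrict X x) * g (a (restrict X x)) (restrict (~: X) x))
  -> schmidt_decomposable X Psi #|T|.
Proof.
move=> PsiE.
exists (fun j => [ffun y => f y * (a y == enum_val j)%:R]).
exists (fun j => [ffun z => g (enum_val j) z]).
apply/ffunP => x; rewrite sum_ffunE (bigD1 (enum_rank (a (restrict X x)))) //=.
rewrite !ffunE enum_rankK eqxx mulr1 -PsiE big1 ?addr0 // => j ja.
rewrite !ffunE; case: eqP => [aj|_]; last by rewrite mulr0 mul0r.
by rewrite aj enum_valK eqxx in ja.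
Qed.

Lemma min_schmidt_terms_le X (Psi : qstate R V) k :
  schmidt_decomposable X Psi k -> (min_schmidt_terms X Psi <= k)%N.
Proof.
move=> Psi_k; rewrite /min_schmidt_terms; case: ex_minnP => m _; apply.
exact/asboolP.
Qed.

Lemma min_schmidt_terms_sc G X d (s : d.-tuple {set V}) : is_sc_system G s ->
  (min_schmidt_terms X (graph_state R G) <= 2 ^ d)%N.
Proof.
move=> /(graph_state_factor R X)[f [a [g GE]]].
have := min_schmidt_terms_le (@schmidt_decomposable_factor _ _ _ f a g GE).
by rewrite card_ffun card_bool card_ord.
Qed.

Lemma min_schmidt_terms_set0 (Psi : qstate R V) :
  (min_schmidt_terms set0 Psi <= 1)%N.
Proof.
rewrite -card_unit; apply: min_schmidt_terms_le.
apply: (@schmidt_decomposable_factor _ _ _ (fun=> 1) (fun=> tt)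
  (fun _ z => Psi (extend0 z))) => x.
rewrite mul1r; congr (Psi _); apply/ffunP => v.
rewrite ffunE; case: insubP => [w _ <-|]; first by rewrite ffunE.
by rewrite !inE.
Qed.

Lemma schmidt_rank_le G X d :
  (min_schmidt_terms X (graph_state R G) <= 2 ^ d)%N ->
  schmidt_rank R G X <= d%:R.
Proof.
rewrite /schmidt_rank => le_d.
have ln2_gt0 : 0 < ln 2 :> R by rewrite ln_gt0 ?ltr1n.
rewrite ler_pdivrMr // mulr_natl -lnXn //.
(* With zero terms, [ln 0] takes its default value 0. *)
case: (posnP (min_schmidt_terms X (graph_state R G))) => [->|m_gt0].
  by rewrite ln0 // lnXn // mulrn_wge0 // ltW.
by rewrite ler_ln ?posrE ?exprn_gt0 ?ltr0n // -natrX ler_nat.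
Qed.

End Decomposition.

Theorem theorem4p3 (R : realType) (V : finType) (G : sgraph V)
    (G_edge : exists u v : V, adj G u v) :
  (c2 G)%:R > avg_schmidt_rank R G.
Proof.
rewrite /c2; case: ex_minnP => d /existsP[s sG] _.
(* The empty system only produces the edgeless graph. *)
have d_gt0 : (0 < d)%N.
  rewrite lt0n; apply/eqP => d0; move: G_edge => [u [v Guv]].
  move: (Guv); rewrite (is_sc_systemP _ _ sG).
    by rewrite (size0nil (etrans (size_tuple s) d0)).
  by apply: contraTneq Guv => ->; rewrite adj_irr.
rewrite /avg_schmidt_rank mulrC ltr_pdivrMr ?exprn_gt0 ?ltr0n //.
have -> : d%:R * 2 ^+ #|V| = \sum_(X : {set V}) d%:R :> R.
  have card_set : #|{: {set V}}| = (2 ^ #|V|)%N.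
    by rewrite -[LHS]cardsT -powersetT card_powerset cardsT.
  by rewrite -natrX -card_set mulr_natr sumr_const.
rewrite (bigD1 set0) //= [ltRHS](bigD1 set0) //=; apply: ltr_leD.
  (* The empty cut needs at most 1 = 2 ^ 0 terms. *)
  apply: (@le_lt_trans _ _ 0%:R); last by rewrite ltr_nat.
  by apply: schmidt_rank_le; apply: min_schmidt_terms_set0.
by apply: ler_sum => X _; exact/schmidt_rank_le/min_schmidt_terms_sc/sG.
Qed.
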